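(* Let $\mathcal M=(\mathcal S,\mathcal A,r,P,\rho)$ be a finite MDP with a parametrized policy class $\{\pi_\theta\}_{\theta\in\Theta}$ such that, for every policy in the class, the induced Markov chain on $\mathcal S$ has a single recurrent class. Let $\theta\in\Theta$ and let $\{s_t\}_{t\ge0}$ be the state sequence induced by the policy $\pi_\theta$. Then, for any $B\ge1$, the probability of hitting the recurrent class $\mathcal S_R^\theta$ within $B$ steps satisfies $$\Pr(T_\theta\le B)\ge1-2^{-\lfloor B/(2C_{\mathrm{hit}})\rfloor}.$$
   Context: $\mathcal S$ and $\mathcal A$ are finite; the chain induced by $\pi_\theta$ has transition matrix $P^{\pi_\theta}(s,s')=\sum_aP(s'|s,a)\pi_\theta(a|s)$. $\mathcal S_R^\theta$ is its recurrent class; $T_\theta=\inf\{t\ge0:s_t\in\mathcal S_R^\theta\}$; $C_{\mathrm{hit}}^\theta=\max_{s\in\mathcal S}\mathbb E_s^\theta[T_\theta]$, where $\mathbb E_s^\theta$ is expectation for the chain under $\pi_\theta$ started at $s$; $C_{\mathrm{hit}}=\sup_\theta C_{\mathrm{hit}}^\theta$. *)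

(* Defs.v *)
From mathcomp Require Export all_boot all_order all_algebra.
From mathcomp Require Export all_classical all_reals all_analysis.
Export Order.TTheory GRing.Theory Num.Theory.
Export numFieldNormedType.Exports.

Set Implicit Arguments.
Unset Strict Implicit.
Unset Printing Implicit Defensive.

Local Open Scope classical_set_scope.
Local Open Scope ring_scope.

Record fdist (R : realType) (T : finType) := FDist {
  fdist_mass :> T -> R;
  fdist_ge0 : forall x, 0 <= fdist_mass x;
  fdist_sum1 : \sum_x fdist_mass x = 1 }.

Record mdp (R : realType) (S A : finType) := MDP {
  mdp_reward : S -> A -> R;
  mdp_trans : S -> A -> fdist R S;
  mdp_init : fdist R S }.

Definition induced_trans (R : realType) (S A : finType) (M : mdp R S A)
    (pol : S -> fdist R A) (s s' : S) : R :=
  \sum_a mdp_trans M s a s' * pol s a.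

(* The Markov property is the usual one,
   Pr(X_{n+1} = x_{n+1} | X_0 = x_0, ..., X_n = x_n) = p(x_n, x_{n+1}),
   multiplied out so that null conditioning events need no special case. *)
Record markov_chain (R : realType) (S : finType) (d : measure_display)
    (Omega : measurableType d) (Pr : probability Omega R)
    (X : nat -> Omega -> S) (init : S -> R) (p : S -> S -> R) : Prop := {
  mc_measurable : forall t x, measurable (X t @^-1` [set x]);
  mc_init : forall x, Pr (X 0%N @^-1` [set x]) = (init x)%:E;
  mc_step : forall (n : nat) (x : nat -> S),
    Pr [set w | forall k, (k <= n.+1)%N -> X k w = x k] =
    (Pr [set w | forall k, (k <= n)%N -> X k w = x k]
      * (p (x n) (x n.+1))%:E)%E }.

(* In the next definitions [Q x] is the law under which the process [X] is the
   chain started at [x]. *)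

Definition recurrent_state (R : realType) (S : finType) (d : measure_display)
    (Omega : measurableType d) (Q : S -> probability Omega R)
    (X : nat -> Omega -> S) (x : S) : Prop :=
  Q x [set w | exists2 n, (0 < n)%N & X n w = x] = 1%E.

Definition accessible (R : realType) (S : finType) (d : measure_display)
    (Omega : measurableType d) (Q : S -> probability Omega R)
    (X : nat -> Omega -> S) (x y : S) : Prop :=
  (0 < Q x [set w | exists n, X n w = y])%E.

Definition recurrent_class (R : realType) (S : finType) (d : measure_display)
    (Omega : measurableType d) (Q : S -> probability Omega R)
    (X : nat -> Omega -> S) (C : set S) : Prop :=
  exists2 x, recurrent_state Q X x
    & C = [set y | accessible Q X x y /\ accessible Q X y x].

(* [+oo] when the path [x] never enters [C]. *)
Definition hitting_time (R : realType) (S : finType) (C : set S)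
    (x : nat -> S) : \bar R :=
  ereal_inf [set (t%:R)%:E | t in [set t : nat | C (x t)]].

Definition hit_const_at (R : realType) (S : finType) (d : measure_display)
    (Omega : measurableType d) (Q : S -> probability Omega R)
    (X : nat -> Omega -> S) (C : set S) : \bar R :=
  \big[maxe/-oo%E]_(s : S) (\int[Q s]_w hitting_time R C (X^~ w))%E.

Definition hit_const (R : realType) (S : finType) (Theta : Type)
    (d : measure_display) (Omega : measurableType d)
    (Q : Theta -> S -> probability Omega R) (X : nat -> Omega -> S)
    (SR : Theta -> set S) : \bar R :=
  ereal_sup (range (fun th => hit_const_at (Q th) X (SR th))).

(* 2 ^ (- floor x) on the extended reals, with 2 ^ (- +oo) = 0. *)
Definition half_pow_floor (R : realType) (x : \bar R) : \bar R :=
  match x with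
  | EFin q => ((2 : R) ^ (- Num.floor q))%:E
  | +oo%E => 0%E
  | -oo%E => +oo%E
  end.

(* Main.v *)
(* By Markov's inequality, from any state the chain avoids the recurrent class
   at the times 0, ..., m with probability at most H / (m + 1), where H is the
   hitting constant; this is at most 1/2 for m = floor (2 H).  By the Markov
   property, k consecutive blocks of m steps all avoid the class with
   probability at most 2^-k, and k = floor (B / (2 H)) such blocks fit in B
   steps. *)

Require Import Defs.

Set Implicit Arguments.
Unset Strict Implicit.
Unset Printing Implicit Defensive.

Local Open Scope classical_set_scope.
Local Open Scope ring_scope.

(** Markov's inequality for a possibly non-measurable [f]: the integral of a nonnegative function is
    the supremum over the simple functions below it, and [c] times the indicator of [A] is one of
    these. *)
Lemma mul_measure_le_integral (R : realType) (d : measure_display)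
    (T : measurableType d) (mu : {measure set T -> \bar R}) (f : T -> \bar R)
    (A : set T) (c : R) :
  measurable A -> 0 <= c -> (forall x, 0 <= f x)%E ->
  (forall x, A x -> (c%:E <= f x)%E) ->
  (c%:E * mu A <= \int[mu]_x f x)%E.
Proof.
move=> mA c0 f0 cf; rewrite ge0_integralTE//; apply: ereal_sup_ubound.
exists (scale_nnsfun (indic_nnsfun R mA) c0) => /=; last first.
  by rewrite sintegralrM sintegral_indic.
move=> x /=; rewrite measurable_realfun.mindicE.
by case: (boolP (x \in A)) => [/set_mem/cf|_]; rewrite ?mulr1 ?mulr0.
Qed.

Lemma measure_sum_fibers (R : realType) (S : finType) (d : measure_display)
    (T : measurableType d) (mu : {measure set T -> \bar R}) (E : set T)
    (Y : T -> S) :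
  (forall y, measurable (E `&` Y @^-1` [set y])) ->
  mu E = (\sum_y mu (E `&` Y @^-1` [set y]))%E.
Proof.
move=> mEY.
have -> : mu E = mu (\bigcup_(y in [set: S]) (E `&` Y @^-1` [set y])).
  congr (mu _); apply/seteqP; split=> [w Ew|w [y _ []]//].
  by exists (Y w).
rewrite measure_fin_bigcup//; [|exact: finite_finset|].
- rewrite (fsbigE (index_enum S))//= ?index_enum_uniq//.
    by apply: eq_bigl => y; rewrite in_setT.
  by move=> y _; rewrite mem_index_enum.
- by move=> i j _ _ [w [[_ <-] [_ <-]]].
Qed.

(** * Hitting times of a fixed path *)

Section hitting_time.
Context {R : realType} {S : finType}.
Implicit Types (C : set S) (x : nat -> S).

Lemma hitting_time_ge C x m :
  (forall k, (k <= m)%N -> ~ C (x k)) -> (m.+1%:R%:E <= hitting_time R C x)%E.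
Proof.
move=> notC; apply: le_ereal_inf_tmp => _ [t Ct <-].
rewrite lee_fin ler_nat ltnNge; apply/negP => tm.
exact: notC Ct.
Qed.

Lemma hitting_time_ge0 C x : (0 <= hitting_time R C x)%E.
Proof. by apply: le_ereal_inf_tmp => _ [t _ <-]; rewrite lee_fin. Qed.

(** Finite hitting times are integers: missing [C] up to [Num.trunc B] pushes the infimum to at
    least [Num.trunc B + 1], which exceeds [B]. *)
Lemma hitting_time_leP C x (B : R) : 0 <= B ->
  (hitting_time R C x <= B%:E)%E <-> exists2 k, (k <= Num.trunc B)%N & C (x k).
Proof.
move=> B0; split=> [hB|[k kB Ck]].
  apply: contrapT => noC.
  have h_gt : ((Num.trunc B).+1%:R%:E <= hitting_time R C x)%E.
    by apply: hitting_time_ge => k kB Ck; apply: noC; exists k.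
  have := le_trans h_gt hB.
  by rewrite lee_fin leNgt -truncn_le_nat leqnn.
apply: ge_ereal_inf; exists k%:R%:E; first by exists k.
rewrite lee_fin (le_trans _ (_ : (Num.trunc B)%:R <= B))//.
  by rewrite ler_nat.
by rewrite truncn_le.
Qed.

End hitting_time.

(* First-step recursion for the probability that the chain with kernel [p]
   started at [x] is outside [C] at each of the times 0, ..., n. *)
Fixpoint avoid (R : realType) (S : finType) (p : S -> S -> R) (C : set S)
    (n : nat) (x : S) : R :=
  (x \in ~` C)%:R * (if n is n'.+1 then \sum_y p x y * avoid p C n' y else 1).

(** * Geometric decay of avoidance probabilities *)

Section avoid.
Context {R : realType} {S : finType} (p : S -> S -> R) (C : set S).
Hypothesis p_ge0 : forall x y, 0 <= p x y.

Lemma avoid_in n x : x \in C -> avoid p C n x = 0.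
Proof. by case: n => [|n] /= xC; rewrite in_setC xC mul0r. Qed.

Lemma avoid0_le1 x : avoid p C 0%N x <= 1.
Proof. by rewrite /= mulr1; case: (_ \in _). Qed.

(** Markov property at time [m]: wherever the first block ends, [n] further steps cost a factor of
    at most [c]. The end of a block is the start of the next, so [k] blocks of [m] steps take
    [k * m] steps. *)
Lemma avoid_add_le (m n : nat) (c : R) x : (forall y, avoid p C n y <= c) ->
  avoid p C (m + n)%N x <= c * avoid p C m x.
Proof.
move=> avoid_c; elim: m x => [|m IH] x.
  rewrite add0n; case: (boolP (x \in C)) => xC.
    by rewrite !avoid_in// mulr0.
  by rewrite [in leRHS]/= in_setC xC !mulr1.
rewrite addSn /= mulrCA ler_wpM2l// mulr_sumr ler_sum// => y _.
by rewrite mulrCA ler_wpM2l.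
Qed.

Lemma avoid_geometric (m k : nat) (c : R) x : 0 <= c ->
  (forall y, avoid p C m y <= c) -> avoid p C (k * m)%N x <= c ^+ k.
Proof.
move=> c0 avoid_c; elim: k x => [|k IH] x.
  by rewrite mul0n avoid0_le1.
rewrite mulSn (le_trans (avoid_add_le _ _ IH))// exprSr ler_wpM2l//.
exact: exprn_ge0.
Qed.

End avoid.

(** * Path events expressed by the recursion [avoid] *)

Section markov_chain.
Context {R : realType} {S : finType} {d : measure_display}.
Context {Omega : measurableType d} {Pr : probability Omega R}.
Context {X : nat -> Omega -> S} {init : S -> R} {p : S -> S -> R}.
Hypothesis X_chain : markov_chain Pr X init p.

Definition stays_out (C : set S) (m n : nat) : set Omega :=
  [set w | forall k, (m <= k <= n)%N -> ~ C (X k w)].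

Definition has_prefix (x : nat -> S) (n : nat) : set Omega :=
  [set w | forall k, (k <= n)%N -> X k w = x k].

Lemma measurable_chain_preimage t (D : set S) : measurable (X t @^-1` D).
Proof.
have -> : X t @^-1` D = \bigcup_(y in D) X t @^-1` [set y].
  apply/seteqP; split=> [w Dw|w [y Dy Xy]]; first by exists (X t w).
  by rewrite /preimage /= Xy.
by apply: fin_bigcup_measurable => // y _; exact: mc_measurable X_chain _ _.
Qed.

Lemma measurable_stays_out C m n : measurable (stays_out C m n).
Proof.
have -> : stays_out C m n =
    \bigcap_(k in [set k | (m <= k <= n)%N]) X k @^-1` (~` C) by [].
by apply: bigcap_measurableType => k _; exact: measurable_chain_preimage.
Qed.

Lemma measurable_has_prefix x n : measurable (has_prefix x n).
Proof.
have -> : has_prefix x n =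
    \bigcap_(k in [set k | (k <= n)%N]) X k @^-1` [set x k] by [].
by apply: bigcap_measurableType => k _; exact: measurable_chain_preimage.
Qed.

(** The chain axioms only give probabilities of full prefixes, so the induction on [r] carries the
    whole prefix up to [j] and splits on the state at time [j.+1]. Prefix and avoidance window share
    the time [j]. *)
Lemma stays_out_prefix C r j x :
  Pr (has_prefix x j `&` stays_out C j (j + r)%N) =
  (Pr (has_prefix x j) * (avoid p C r (x j))%:E)%E.
Proof.
elim: r j x => [|r IH] j x.
  rewrite addn0 /= mulr1 in_setC; case: (boolP (x j \in C)) => xC /=.
    rewrite mule0 (_ : _ `&` _ = set0) ?measure0//.
    apply/seteqP; split=> // w [/(_ j (leqnn _)) Xj] /(_ j).
    by rewrite leqnn Xj => /(_ isT); apply; exact: set_mem.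
  rewrite mule1; congr (Pr _); apply/seteqP; split=> [w []//|w pre]; split=> //.
  move=> k; rewrite -eqn_leq => /eqP <-; rewrite pre//.
  by move=> /mem_set; apply/negP.
case: (boolP (x j \in C)) => xC.
  rewrite avoid_in// mule0 (_ : _ `&` _ = set0) ?measure0//.
  apply/seteqP; split=> // w [/(_ j (leqnn _)) Xj] /(_ j).
  by rewrite leqnn leq_addr Xj => /(_ isT); apply; exact: set_mem.
(* The path [x] up to time [j], then [y]; its values after [j.+1] are irrelevant. *)
pose ext y k := if (k <= j)%N then x k else y.
have prefix_ext y : has_prefix (ext y) j = has_prefix x j.
  by apply/seteqP; split=> w pre k kj; rewrite pre// /ext kj.
have ext_last y : ext y j.+1 = y by rewrite /ext ltnn.
rewrite (@measure_sum_fibers _ _ _ _ Pr _ (X j.+1)); last first.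
  move=> y; apply: measurableI; last exact: measurable_chain_preimage.
  by apply: measurableI;
    [exact: measurable_has_prefix|exact: measurable_stays_out].
transitivity (\sum_y (Pr (has_prefix x j) * (p (x j) y * avoid p C r y)%:E))%E.
  apply: eq_bigr => y _.
  transitivity (Pr (has_prefix (ext y) j.+1 `&` stays_out C j.+1 (j.+1 + r)%N)).
    congr (Pr _); apply/seteqP; split=> w.
      move=> [[pre out] Xy]; split.
        move=> k; rewrite leq_eqVlt => /predU1P[->|]; first by rewrite ext_last.
        by rewrite ltnS => kj; rewrite pre// /ext kj.
      by move=> k /andP[jk kr]; apply: out; rewrite (ltnW jk) -addSnnS.
    move=> [pre out]; split; last by rewrite /= pre// ext_last.
    have pre_x : has_prefix x j w.
      by move=> k kj; rewrite pre ?(leqW kj)// /ext kj.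
    split=> // k /andP[]; rewrite leq_eqVlt => /predU1P[<- _|jk kr].
      by rewrite pre_x// => /mem_set; apply/negP.
    by apply: out; rewrite jk addSnnS.
  rewrite IH ext_last [X in (X * _)%E](mc_step X_chain j (ext y)).
  rewrite -/(has_prefix (ext y) j) prefix_ext ext_last /ext leqnn.
  by rewrite -muleA EFinM.
rewrite /= in_setC xC mul1r.
rewrite -(fineK (fin_num_measure Pr _ (measurable_has_prefix x j))).
by rewrite -EFinM mulr_sumr -sumEFin; apply: eq_bigr => y _; rewrite -EFinM.
Qed.

Lemma stays_out_init C n :
  Pr (stays_out C 0%N n) = (\sum_x init x * avoid p C n x)%:E.
Proof.
rewrite (@measure_sum_fibers _ _ _ _ Pr _ (X 0%N)); last first.
  move=> y; apply: measurableI; last exact: measurable_chain_preimage.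
  exact: measurable_stays_out.
rewrite -sumEFin; apply: eq_bigr => x _.
have -> : X 0%N @^-1` [set x] = has_prefix (fun=> x) 0%N.
  by apply/seteqP; split=> [w Xx k|w /(_ 0%N)];
    [rewrite leqn0 => /eqP ->|exact].
rewrite setIC -[LHS]/(Pr (_ `&` stays_out C 0%N (0 + n)%N)).
rewrite stays_out_prefix EFinM.
congr (_ * _)%E; rewrite -(mc_init X_chain x); congr (Pr _).
by apply/seteqP; split=> [w /(_ 0%N)|w Xx k]; [exact|rewrite leqn0 => /eqP ->].
Qed.

(** Avoiding [C] up to [Num.trunc B] implies avoiding it up to [n], and a bound uniform in the
    starting state survives averaging over [init]. *)
Lemma prob_hitting_time_ge C (B : R) (n : nat) (c : R) :
  0 <= B -> (n <= Num.trunc B)%N -> (forall x, 0 <= init x) ->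
  \sum_x init x = 1 -> (forall x, avoid p C n x <= c) ->
  ((1 - c)%:E <= Pr [set w | (hitting_time R C (X^~ w) <= B%:E)%E])%E.
Proof.
move=> B0 nB init_ge0 init1 avoid_c.
have -> : [set w | (hitting_time R C (X^~ w) <= B%:E)%E] =
    ~` stays_out C 0%N (Num.trunc B).
  apply/seteqP; split=> w.
    by move=> /(hitting_time_leP _ _ B0)[k kB Ck] /(_ k kB).
  move=> out; apply/(hitting_time_leP _ _ B0).
  apply: contrapT => noC; apply: out.
  by move=> k kB Ck; apply: noC; exists k.
rewrite probability_setC; last exact: measurable_stays_out.
rewrite EFinB leeB//.
have sub : stays_out C 0%N (Num.trunc B) `<=` stays_out C 0%N n.
  by move=> w out k kn; apply: out; exact: leq_trans nB.
apply: le_trans (le_measure Pr _ _ sub) _; rewrite ?inE;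
  try exact: measurable_stays_out.
rewrite -[X in (X <= _)%E]/(Pr (stays_out C 0%N n)) stays_out_init.
rewrite lee_fin -[leRHS]mul1r -init1 mulr_suml.
by apply: ler_sum => x _; rewrite ler_wpM2l.
Qed.

End markov_chain.

Lemma avoid_le_hit_const_at (R : realType) (S : finType) (d : measure_display)
    (Omega : measurableType d) (Q : S -> probability Omega R)
    (X : nat -> Omega -> S) (p : S -> S -> R) (C : set S) m y :
  (forall x, markov_chain (Q x) X (fun z => (z == x)%:R) p) ->
  ((m.+1%:R * avoid p C m y)%:E <= hit_const_at Q X C)%E.
Proof.
move=> X_chain; apply: le_trans (le_bigmax _ _ y).
(* Written as an average over the point mass at [y], to match [stays_out_init]. *)
have -> : avoid p C m y = \sum_x (x == y)%:R * avoid p C m x.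
  rewrite (bigD1 y)//= eqxx mul1r big1 ?addr0// => x /negbTE ->.
  by rewrite mul0r.
rewrite EFinM -(stays_out_init (X_chain y)).
apply: mul_measure_le_integral => //.
- exact: measurable_stays_out (X_chain y) _ _ _.
- by move=> w; exact: hitting_time_ge0.
- by move=> w out; apply: hitting_time_ge => k; exact: out.
Qed.


Theorem lemma10 (R : realType) (S A : finType) (M : mdp R S A)
    (Theta : Type) (policy : Theta -> S -> fdist R A)
    (* laws Q th x, for the chain under policy th started at x *)
    (d : measure_display) (Omega : measurableType d)
    (X : nat -> Omega -> S) (Q : Theta -> S -> probability Omega R)
    (X_chain : forall (th : Theta) (x : S),
       markov_chain (Q th x) X (fun y => (y == x)%:R)
         (induced_trans M (policy th)))
    (* SR th is the single recurrent class under policy th *)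
    (SR : Theta -> set S)
    (single_class : forall th : Theta,
       unique (recurrent_class (Q th) X) (SR th))
    (theta : Theta)
    (d' : measure_display) (Omega' : measurableType d')
    (Pr : probability Omega' R) (s : nat -> Omega' -> S)
    (s_chain : markov_chain Pr s (mdp_init M)
       (induced_trans M (policy theta)))
    (B : R) (B_ge1 : 1 <= B) :
  (1 - half_pow_floor (B%:E / (2%:E * hit_const Q X SR)) <=
   Pr [set w | hitting_time R (SR theta) (s^~ w) <= B%:E])%E.

Proof.
set H := hit_const Q X SR; set p := induced_trans M (policy theta).
set C := SR theta.
have p_ge0 x y : 0 <= p x y.
  by apply: sumr_ge0 => a _; rewrite mulr_ge0 ?fdist_ge0.
have B0 : 0 <= B by exact: le_trans B_ge1.
have avoid_H m y : ((m.+1%:R * avoid p C m y)%:E <= H)%E.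
  apply: le_trans (avoid_le_hit_const_at C m y (X_chain theta)) _.
  by apply: ereal_sup_ubound; exists theta.
have hit n c : (n <= Num.trunc B)%N -> (forall x, avoid p C n x <= c) ->
    ((1 - c)%:E <= Pr [set w | hitting_time R C (s^~ w) <= B%:E])%E.
  move=> nB.
  apply: (prob_hitting_time_ge s_chain) => //; first exact: fdist_ge0.
  exact: fdist_sum1.
(* The initial law has mass 1, so a state exists; this excludes [H = -oo], the maximum over no
   states, and makes a finite [H] nonnegative. *)
have [x0 _] : exists x0 : S, true.
  case: (pickP (mem S)) => [x0 _|S0]; first by exists x0.
  have := fdist_sum1 (mdp_init M); rewrite big1 => [/esym/eqP|x _].
    by rewrite oner_eq0.
  by have := S0 x.
have avoid_ge0 n x : 0 <= avoid p C n x.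
  elim: n x => [|n IH] x /=; rewrite mulr_ge0// sumr_ge0// => y _.
  by rewrite mulr_ge0.
case: H avoid_H => [h| |] avoid_h; last first.
- by have := avoid_h 0%N x0; rewrite leeNy_eq.
(* For [H = +oo] the exponent is 0 and the bound is the trivial [1 - 1 = 0]. *)
- rewrite gt0_muley ?lte_fin// invey mule0 /= floor0 oppr0 expr0z subee//.
- rewrite -EFinM inver; case: eqP => [/eqP|/eqP h2_neq0].
    rewrite mulf_eq0 pnatr_eq0 /= => /eqP h0.
    (* [B / 0 = +oo], so the bound to prove is [1 - 0]. *)
    rewrite gt0_muley ?lte_fin ?(lt_le_trans ltr01)//= sube0.
    (* Since [H = 0], avoidance at time 0 has probability 0 from every state: all states lie in
       [C]. *)
    have := hit 0%N 0 (leq0n _); rewrite subr0; apply => x.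
    by have := avoid_h 0%N x; rewrite h0 mul1r lee_fin.
  have h_ge0 : 0 <= h.
    by have := avoid_h 0%N x0; rewrite mul1r lee_fin; exact: le_trans.
  have h2_gt0 : 0 < 2 * h by rewrite lt_neqAle eq_sym h2_neq0 mulr_ge0.
  set q := B / (2 * h).
  have q_ge0 : 0 <= q by rewrite divr_ge0// ltW.
  have -> : (B%:E * ((2 * h)^-1)%:E)%E = q%:E by [].
  rewrite /half_pow_floor.
  have -> : Num.floor q = (Num.trunc q)%:Z.
    by rewrite truncn_floor q_ge0 gez0_abs// floor_ge0.
  rewrite -[1%E]/(1%:E) -EFinB.
  (* The blocks fit because the product of the truncations is at most [q * (2 * h) = B]. If
     [2 * h < 1] they have length 0, and the bound 1/2 per block still holds. *)
  apply: (hit (Num.trunc q * Num.trunc (2 * h))%N) => [|x].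
    rewrite truncn_ge_nat// natrM -[leRHS](divfK h2_neq0) ler_pM//.
      by rewrite truncn_le.
    by rewrite truncn_le ltW.
  rewrite -exprnN -exprVn; apply: avoid_geometric => // y.
  have := avoid_h (Num.trunc (2 * h)) y; rewrite lee_fin => avoid_h2.
  (* The successor, from avoiding at [m + 1] times, is what brings the ratio below 1/2. *)
  have h_lt : h < (Num.trunc (2 * h)).+1%:R / 2.
    by rewrite ltr_pdivlMr// mulrC truncnS_gt.
  rewrite -(@ler_pM2l _ (Num.trunc (2 * h)).+1%:R)//.
  exact: le_trans avoid_h2 (ltW h_lt).
Qed.
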